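(* Let $\mathcal C$ be any one of the following four categories: locally ordered Hausdorff spaces; strictly locally ordered Hausdorff spaces; locally Nachbin ordered Hausdorff spaces; strictly locally Nachbin ordered Hausdorff spaces. Let $X$ be an object of $\mathcal C$ (in particular the underlying topology of $X$ is Hausdorff) and let $\ast\in X$. In $\mathcal C$, there exists a coequalizer of $i_\ast,c_\ast:S^1\to\overrightarrow{S^1}\times X$ if, and only if, the family of clopen neighbourhoods of $\ast$ in $X$ has a smallest element $O$ (with respect to inclusion). In that case, $q_O:\overrightarrow{S^1}\times X\to X_O$ is the coequalizer.
   Context: **Locally ordered spaces.** For posets $B,B'$ write $B\subset_{lax}B'$ when $|B|\subset|B'|$ and $p\leq_B q$ implies $p\leq_{B'}q$ for all $p,q\in B$; write $B\subset_{str}B'$ when $|B|\subset |B'|$ and $\leq_B$ is the restriction of $\leq_{B'}$ to $B$. An *ordered basis* on a topological space $X$ is a set $\mathfrak B$ of posets whose underlying sets form a basis of the topology of $X$ and such that for all $x\in X$ and $B,B'\in\mathfrak B$ with $x\in B\cap B'$ there is $B''\in\mathfrak B$ with $x\in B''$, $B''\subset_{lax}B$ and $B''\subset_{lax}B'$. It is *strict* if one can always find such $B''$ with $B''\subset_{str}B$ and $B''\subset_{str}B'$. An ordered basis $\mathfrak B'$ is *coarser* than $\mathfrak B$ if for every $x\in X$ and every $B'\in\mathfrak B'$ with $x\in B'$ there is $B\in\mathfrak B$ with $x\in B\subset_{lax}B'$; two ordered bases are *equivalent* if each is coarser than the other. A *locally ordered space* is a topological space with an equivalence class of ordered bases; it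 is a *strictly* locally ordered space if the class contains a strict basis, and Hausdorff if its underlying topological space is. Its *open posets* are the posets $A$ with $|A|\subset X$ such that for every $x\in A$ there is $B\in\mathfrak B$ with $x\in B\subset_{lax}A$ (for $\mathfrak B$ any basis in the class); they form the largest ordered basis of the class, denoted $\overrightarrow{\mathcal O}(X)$. **Nachbin.** A *Nachbin ordered space* is a topological space $P$ with a partial order that is closed in $P\times P$. A locally ordered space $X$ is *locally Nachbin ordered* if for all $x\in X$ and $O\in\overrightarrow{\mathcal O}(X)$ with $x\in O$ there is $O'\in\overrightarrow{\mathcal O}(X)$ with $x\in O'\subset_{lax}O$ that is a Nachbin ordered space for the topology inherited from $X$. A strictly locally Nachbin ordered space is a strictly locally ordered space that is locally Nachbin ordered. **Morphisms.** A map $f:X\to Y$ between locally ordered spaces with ordered bases $\mathfrak B,\mathfrak B'$ is *locally increasing at* $x$ if for all $B'\in\mathfrak B'$ with $f(x)\in B'$ there is $B\in\mathfrak B$ with $x\in B$, $f(B)\subset B'$ and $f:B\to B'$ increasing (independent of the bases in the classes). It is locally increasing if it is so at every point. These are the morphisms of all the categories considered. The product $X\times X'$ has ordered basis $\{B\times B'\}$ with product topology and product orders. **Circles.** $S^1=\{z\in\mathbb C:|z|=1\}$. A *proper open arc* is a set $\{e^{ix}: x\in{]a,b[}\}$ with $0<b-a<2\pi$; its standard order is $e^{ix}\leq e^{iy}$ iff $x\leq y$, for $x,y\in{]a,b[}$ (it depends only on the arc $\alpha$ and is written $\leq_\alpha$). The *directed circle* $\overrightarrow{S^1}$ has as ordered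 basis all proper open arcs with their standard orders. $S^1$, as a locally ordered space, is the *unordered circle*: proper open arcs ordered by equality. **The maps.** $i_\ast(s)=(s,\ast)$ and $c_\ast(s)=(1,\ast)$. **The space $X_O$.** For an open neighbourhood $O$ of $\ast$, let $X_O=O\sqcup (S^1\times(X\setminus O))$ and $q_O:\overrightarrow{S^1}\times X\to X_O$, $q_O(s,t)=t$ if $t\in O$, $q_O(s,t)=(s,t)$ if $t\notin O$. $X_O$ carries the final topology of $q_O$. For a proper open arc $\alpha$ and $A\in\overrightarrow{\mathcal O}(X)$ let $U_{\alpha,A}=q_O(\alpha\times A)=(O\cap A)\sqcup(\alpha\times(A\setminus O))$, ordered by $\leq_{\alpha,A}$, the transitive closure of the image of the product order on $\alpha\times A$ under $q_O$. The posets $(U_{\alpha,A},\leq_{\alpha,A})$ form the ordered basis that makes $X_O$ a locally ordered space. *)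

(* Defs.v *)
From HB Require Import structures.
From Stdlib Require Import Relation_Operators.
From mathcomp Require Import all_boot all_order all_algebra complex ring lra.
From mathcomp Require Import all_classical all_reals all_analysis.
Set Implicit Arguments.
Unset Strict Implicit.
Unset Printing Implicit Defensive.
Import Order.TTheory GRing.Theory Num.Theory numFieldNormedType.Exports.
Local Open Scope classical_set_scope.
Local Open Scope ring_scope.
Local Open Scope complex_scope.

(* A poset whose underlying set is a subset of T.  The order is supported on
   the carrier, so that two such posets are equal when their carriers and
   orders have the same elements. *)
Record oset (T : Type) := OSet {
  carrier : set T;
  ole : T -> T -> Prop;
  ole_supp : forall p q, ole p q -> carrier p /\ carrier q;
  ole_refl : forall p, carrier p -> ole p p;
  ole_anti : forall p q, ole p q -> ole q p -> p = q;
  ole_trans : forall p q r, ole p q -> ole q r -> ole p r }.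

Definition sub_lax (T : Type) (B B' : oset T) : Prop :=
  carrier B `<=` carrier B' /\ forall p q, ole B p q -> ole B' p q.

Definition sub_str (T : Type) (B B' : oset T) : Prop :=
  carrier B `<=` carrier B' /\
  forall p q, carrier B p -> carrier B q -> (ole B p q <-> ole B' p q).

Definition ordered_basis (X : topologicalType) (F : set (oset X)) : Prop :=
  basis [set carrier B | B in F] /\
  forall x B B', F B -> F B' -> carrier B x -> carrier B' x ->
    exists B'', [/\ F B'', carrier B'' x, sub_lax B'' B & sub_lax B'' B'].

Definition strict_basis (X : topologicalType) (F : set (oset X)) : Prop :=
  ordered_basis F /\
  forall x B B', F B -> F B' -> carrier B x -> carrier B' x ->
    exists B'', [/\ F B'', carrier B'' x, sub_str B'' B & sub_str B'' B'].

Definition coarser (X : topologicalType) (F' F : set (oset X)) : Prop :=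
  forall x B', F' B' -> carrier B' x ->
    exists B, [/\ F B, carrier B x & sub_lax B B'].

Definition equiv_basis (X : topologicalType) (F F' : set (oset X)) : Prop :=
  coarser F F' /\ coarser F' F.

Definition basis_class (X : topologicalType) (F : set (oset X)) :
    set (set (oset X)) :=
  [set F' | ordered_basis F' /\ equiv_basis F F'].

Record loSpace := LoSpace {
  lo_top :> topologicalType;
  lo_class : set (set (oset lo_top));
  lo_classP : exists2 F, ordered_basis F & lo_class = basis_class F }.

Definition lo_of_basis (X : topologicalType) (F : set (oset X))
    (bF : ordered_basis F) : loSpace :=
  @LoSpace X (basis_class F) (ex_intro2 _ _ F bF erefl).

Definition open_posets (X : loSpace) : set (oset X) :=
  [set A | forall F, lo_class F -> forall x, carrier A x ->
     exists B, [/\ F B, carrier B x & sub_lax B A]].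
Arguments open_posets : clear implicits.

Definition strict_lo (X : loSpace) : Prop :=
  exists2 F : set (oset X), lo_class F & strict_basis F.

(* The carrier of A, as the type [set_type (carrier A)], has the topology
   induced by X. *)
Definition nachbin (X : topologicalType) (A : oset X) : Prop :=
  closed [set p : set_type (carrier A) * set_type (carrier A) |
            ole A (set_val p.1) (set_val p.2)].

Definition locally_nachbin (X : loSpace) : Prop :=
  forall (x : X) O, open_posets X O -> carrier O x ->
    exists O', [/\ open_posets X O', carrier O' x, sub_lax O' O & nachbin O'].

Definition locally_increasing_at (X Y : loSpace) (f : X -> Y) (x : X) : Prop :=
  forall F F', lo_class F -> lo_class F' ->
  forall B', F' B' -> carrier B' (f x) ->
    exists B, [/\ F B, carrier B x, [set f p | p in carrier B] `<=` carrier B' &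
      forall p q, ole B p q -> ole B' (f p) (f q)].

Record loHom (X Y : loSpace) := LoHom {
  lo_fun :> X -> Y;
  lo_funP : forall x, locally_increasing_at lo_fun x }.

(* All the categories considered are full subcategories of the category of
   locally ordered spaces; they differ only in their classes of objects. *)
Inductive lo_category :=
  | LoHausdorff
  | StrictLoHausdorff
  | LocallyNachbinHausdorff
  | StrictLocallyNachbinHausdorff.

Definition objects (C : lo_category) (X : loSpace) : Prop :=
  hausdorff_space X /\
  match C with
  | LoHausdorff => True
  | StrictLoHausdorff => strict_lo X
  | LocallyNachbinHausdorff => locally_nachbin X
  | StrictLocallyNachbinHausdorff => strict_lo X /\ locally_nachbin X
  end.

Definition is_coequalizer (C : lo_category) (A B Q : loSpace)
    (f g : loHom A B) (q : loHom B Q) : Prop :=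
  [/\ objects C Q,
      forall a, q (f a) = q (g a) &
      forall (Y : loSpace) (h : loHom B Y), objects C Y ->
        (forall a, h (f a) = h (g a)) ->
        exists! k : loHom Q Y, forall b, k (q b) = h b].

Section basis_theory.
Variable X : topologicalType.
Implicit Types (B : oset X) (F : set (oset X)).

Lemma sub_lax_refl (T : Type) (B : oset T) : sub_lax B B.
Proof. by split. Qed.

Lemma sub_lax_trans (T : Type) (B1 B2 B3 : oset T) :
  sub_lax B1 B2 -> sub_lax B2 B3 -> sub_lax B1 B3.
Proof.
by move=> [s12 o12] [s23 o23]; split=> [x /s12/s23//|p q /o12/o23].
Qed.

Lemma sub_str_lax (T : Type) (B B' : oset T) : sub_str B B' -> sub_lax B B'.
Proof.
move=> [sBB' oBB']; split=> // p q pq.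
by have [Bp Bq] := ole_supp pq; apply/oBB'.
Qed.

Lemma coarser_refl F : coarser F F.
Proof. by move=> x B FB Bx; exists B; split=> //; exact: sub_lax_refl. Qed.

Lemma coarser_trans F1 F2 F3 : coarser F1 F2 -> coarser F2 F3 -> coarser F1 F3.
Proof.
move=> c12 c23 x B1 /c12/[apply] -[B2 [/c23/[apply] -[B3 [? ? s32]] s21]].
by exists B3; split=> //; apply: sub_lax_trans s21.
Qed.

Lemma ordered_basisP F :
  ordered_basis F <->
  [/\ forall B, F B -> open (carrier B),
      forall (x : X) (U : set X), open U -> U x ->
        exists B, [/\ F B, carrier B x & carrier B `<=` U] &
      forall x B B', F B -> F B' -> carrier B x -> carrier B' x ->
        exists B'', [/\ F B'', carrier B'' x, sub_lax B'' B & sub_lax B'' B']].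
Proof.
split=> [[[oF bF] iF]|[oF bF iF]].
  split=> //; first by move=> B FB; apply: oF; exists B.
  move=> x U oU Ux; have /bF : nbhs x U by exact: open_nbhs_nbhs.
  by move=> [_ [[B FB <-] Bx] BU]; exists B.
split=> //; split=> [_ [B FB <-]|x U]; first exact: oF.
rewrite nbhsE => -[V [oV Vx] VU]; have [B [FB Bx BV]] := bF x V oV Vx.
by exists (carrier B); [split=> //; exists B|apply: subset_trans VU].
Qed.

End basis_theory.

Section lo_theory.
Variable X : loSpace.

Lemma lo_class_basis F : lo_class F -> @ordered_basis X F.
Proof. by have [F0 _ ->] := lo_classP X => -[]. Qed.

Lemma lo_class_coarser F F' : @lo_class X F -> lo_class F' -> coarser F F'.
Proof.
have [F0 _ ->] := lo_classP X => -[_ [_ c1]] [_ [c2 _]].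
exact: coarser_trans c1 c2.
Qed.

Lemma lo_class_ex : exists F, @lo_class X F.
Proof.
have [F0 b0 ->] := lo_classP X.
by exists F0; split=> //; split; exact: coarser_refl.
Qed.

Lemma lo_class_open_posets F : lo_class F -> F `<=` open_posets X.
Proof. by move=> cF B FB F' cF' x Bx; exact: (lo_class_coarser cF cF' FB). Qed.

Lemma open_posets_ordered_basis : ordered_basis (open_posets X).
Proof.
have [F cF] := lo_class_ex.
have /ordered_basisP [oF bF iF] := lo_class_basis cF.
have FO := lo_class_open_posets cF.
apply/ordered_basisP; split.
- move=> A OA; rewrite openE => x Ax; have [B [FB Bx [BA _]]] := OA F cF x Ax.
  by apply: filterS BA _; apply: open_nbhs_nbhs; split=> //; exact: oF.
- by move=> x U oU Ux; have [B [/FO]] := bF x U oU Ux; exists B.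
- move=> x A A' OA OA' Ax A'x.
  have [B [FB Bx BA]] := OA F cF x Ax.
  have [B' [FB' B'x BA']] := OA' F cF x A'x.
  have [B'' [/FO FB'' B''x s s']] := iF x B B' FB FB' Bx B'x.
  by exists B''; split=> //; [exact: sub_lax_trans BA|exact: sub_lax_trans BA'].
Qed.

End lo_theory.

(* Locally increasing maps can be tested on any choice of bases. *)
Lemma locally_increasing_atP (X Y : loSpace) (F : set (oset X)) (F' : set (oset Y))
    (f : X -> Y) (x : X) :
  lo_class F -> lo_class F' ->
  (forall B', F' B' -> carrier B' (f x) ->
    exists B, [/\ F B, carrier B x, [set f p | p in carrier B] `<=` carrier B' &
      forall p q, ole B p q -> ole B' (f p) (f q)]) ->
  locally_increasing_at f x.
Proof.
move=> cF cF' H G G' cG cG' D' GD' D'fx.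
have [B' [FB' B'fx [sBD oBD]]] := lo_class_coarser cG' cF' GD' D'fx.
have [B [FB Bx iB oB]] := H B' FB' B'fx.
have [D [GD Dx [sDB oDB]]] := lo_class_coarser cF cG FB Bx.
exists D; split=> // [_ [p Dp <-]|p q /oDB/oB/oBD//].
by apply/sBD/iB; exists p => //; exact: sDB.
Qed.


Lemma lo_of_basis_class (X : topologicalType) (F : set (oset X))
    (bF : ordered_basis F) :
  @lo_class (lo_of_basis bF) F.
Proof. by split=> //; split; exact: coarser_refl. Qed.

Section product.

Section oset_prod.
Variables (S T : Type) (A : oset S) (B : oset T).

Definition prod_le (p q : S * T) := ole A p.1 q.1 /\ ole B p.2 q.2.

Lemma prod_le_supp p q : prod_le p q ->
  (carrier A `*` carrier B) p /\ (carrier A `*` carrier B) q.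
Proof.
by move=> [a b]; have [? ?] := ole_supp a; have [? ?] := ole_supp b.
Qed.

Lemma prod_le_refl p : (carrier A `*` carrier B) p -> prod_le p p.
Proof. by move=> [? ?]; split; exact: ole_refl. Qed.

Lemma prod_le_anti p q : prod_le p q -> prod_le q p -> p = q.
Proof.
case: p q => [p1 p2] [q1 q2] [/= a b] [/= c d].
by rewrite (ole_anti a c) (ole_anti b d).
Qed.

Lemma prod_le_trans p q r : prod_le p q -> prod_le q r -> prod_le p r.
Proof. by move=> [a b] [c d]; split; [apply: ole_trans c|apply: ole_trans d]. Qed.

Definition oset_prod : oset (S * T) :=
  OSet prod_le_supp prod_le_refl prod_le_anti prod_le_trans.

End oset_prod.

Definition prod_basis (S T : Type) (F : set (oset S)) (F' : set (oset T)) :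
    set (oset (S * T)) :=
  [set oset_prod B B' | B in F & B' in F'].

Lemma oset_prod_lax (S T : Type) (A A' : oset S) (B B' : oset T) :
  sub_lax A A' -> sub_lax B B' -> sub_lax (oset_prod A B) (oset_prod A' B').
Proof.
move=> [sA oA] [sB oB]; split=> [[x y] [/= /sA ? /sB ?]//|p q [/oA ? /oB ?]].
by split.
Qed.

Lemma prod_ordered_basis (X Y : topologicalType) (F : set (oset X))
    (F' : set (oset Y)) :
  ordered_basis F -> ordered_basis F' -> ordered_basis (prod_basis F F').
Proof.
move=> /ordered_basisP [oF bF iF] /ordered_basisP [oF' bF' iF'].
apply/ordered_basisP; split.
- move=> _ [B FB [B' FB' <-]] /=; rewrite openE => -[x y] [/= Bx B'y].
  exists (carrier B, carrier B') => //=; split; apply: open_nbhs_nbhs; split=> //.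
    exact: oF.
  exact: oF'.
- move=> [x y] U oU Uxy; have : nbhs (x, y) U by exact: open_nbhs_nbhs.
  case=> -[V W] /=; rewrite !nbhsE => -[[V' [oV V'x] VV] [W' [oW W'y] WW]] VWU.
  have [B [FB Bx BV]] := bF x V' oV V'x.
  have [B' [FB' B'y B'W]] := bF' y W' oW W'y.
  exists (oset_prod B B'); split=> //; first by exists B => //; exists B'.
  by move=> [x' y'] [/= /BV/VV ? /B'W/WW ?]; exact: VWU.
- move=> [x y] _ _ [A FA [A' FA' <-]] [B FB [B' FB' <-]].
  move=> [/= Ax A'y] [/= Bx B'y].
  have [C [FC Cx CA CB]] := iF x A B FA FB Ax Bx.
  have [C' [FC' C'y CA' CB']] := iF' y A' B' FA' FB' A'y B'y.
  exists (oset_prod C C'); split=> //; first by exists C => //; exists C'.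
    exact: oset_prod_lax.
  exact: oset_prod_lax.
Qed.

Definition lo_prod (X Y : loSpace) : loSpace :=
  lo_of_basis (prod_ordered_basis (@open_posets_ordered_basis X)
                                  (@open_posets_ordered_basis Y)).

End product.

Section circle.
Variable R : realType.
Implicit Types x y a b m h : R.

Definition circle : topologicalType := set_type [set z : R[i]^o | `|z| = 1].

Definition cexpi x : R[i] := cos x +i* sin x.

Lemma norm_cexpi x : [set z : R[i]^o | `|z| = 1] (cexpi x).
Proof. by rewrite /= normc_def /= cos2Dsin2 sqrtr1. Qed.

Definition expi x : circle := exist _ (cexpi x : R[i]^o) (mem_set (norm_cexpi x)).

Lemma expi_eq x y : expi x = expi y <-> cos x = cos y /\ sin x = sin y.
Proof.
split=> [/(congr1 val) /= [-> ->]//|[cxy sxy]].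
by apply/val_inj => /=; rewrite /cexpi cxy sxy.
Qed.

Lemma expiDl x y t : expi x = expi y -> expi (x + t) = expi (y + t).
Proof. by move=> /expi_eq[c s]; apply/expi_eq; rewrite !cosD !sinD c s. Qed.

Lemma expi_inj a b x y : 0 < b - a < pi *+ 2 -> a < x < b -> a < y < b ->
  expi x = expi y -> x = y.
Proof.
move=> /andP[_ ab]; wlog xy : x y / x <= y => [H xab yab e|].
  have [xy|/ltW xy] := leP x y; first exact: H.
  by apply/esym; exact: H.
move=> /andP[ax _] /andP[_ yb] /expi_eq[c s].
apply/eqP; rewrite eq_le xy /= leNgt; apply/negP => xlty.
have : 0 < sin ((y - x) / 2).
  apply: sin_gt0_pi; rewrite divr_gt0 ?subr_gt0//= ltr_pdivrMr// mulr_natr.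
  by lra.
have e : y - x = ((y - x) / 2) *+ 2 by rewrite -mulr_natr mulfVK.
have := cos_mulr2n ((y - x) / 2); rewrite -e cosB -c -s -!expr2 cos2Dsin2 cos2sin2.
move=> H sgt0; have : 0 < sin ((y - x) / 2) ^+ 2 by rewrite exprn_gt0.
by lra.
Qed.

Lemma circle_norm (z : circle) :
  complex.Re (val z) ^+ 2 + complex.Im (val z) ^+ 2 = 1.
Proof.
case: z => /= z /set_mem /= nz; have := add_Re2_Im2 z.
by rewrite nz expr1n => -[].
Qed.

Lemma circle_polar m (z : circle) : exists y, [/\ z = expi (m + y),
  - pi <= y <= pi &
  cos y = complex.Re (val z) * cos m + complex.Im (val z) * sin m].
Proof.
have nz := circle_norm z; have nm := cos2Dsin2 m.
set p := complex.Re (val z) in nz *; set q := complex.Im (val z) in nz *.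
set c := p * cos m + q * sin m; set s := q * cos m - p * sin m.
have cs : c ^+ 2 + s ^+ 2 = 1.
  by rewrite -nz -[RHS]mulr1 -nm /c /s; ring.
have c1 : -1 <= c <= 1 by apply/andP; split; nra.
have [y [cy sy ypi]] : exists y, [/\ cos y = c, sin y = s & - pi <= y <= pi].
  have sE : sin (acos c) = `|s|.
    by rewrite sin_acos// -cs [_ + _ - _]addrAC subrr add0r sqrtr_sqr.
  have [a0 api] := (acos_ge0 c1, acos_lepi c1); have p0 := pi_ge0 R.
  have [s0|s0] := leP 0 s.
    exists (acos c); rewrite acosK// sE ger0_norm//; split=> //; apply/andP; split; lra.
  exists (- acos c); rewrite cosN acosK// sinN sE ltr0_norm// opprK.
  by split=> //; apply/andP; split; lra.
exists y; split=> //; apply/val_inj => /=; rewrite /cexpi cosD sinD cy sy.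
have -> : cos m * c - sin m * s = p.
  by rewrite -[RHS]mulr1 -nm /c /s; ring.
have -> : sin m * c + cos m * s = q.
  by rewrite -[RHS]mulr1 -nm /c /s; ring.
by rewrite /p /q; case: (z) => -[].
Qed.

Lemma expi_surj (z : circle) : exists x, z = expi x.
Proof. by have [y [-> _ _]] := circle_polar 0 z; exists (0 + y). Qed.

Lemma val_circle_continuous : continuous (val : circle -> R[i]^o).
Proof. exact: initial_continuous. Qed.

Lemma Re_continuous : continuous (fun z : R[i]^o => complex.Re z : R^o).
Proof.
move=> z A /nbhs_ballP[e /= e0 eA]; apply/(@nbhs_ballP _ R[i]^o).
exists e%:C => /=; first by rewrite ltcR.
move=> t zt; apply: eA; rewrite -ball_normE /= -ltcR; apply: le_lt_trans zt.
by rewrite -raddfB; exact: normc_ge_Re.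
Qed.

Lemma Im_continuous : continuous (fun z : R[i]^o => complex.Im z : R^o).
Proof.
move=> z A /nbhs_ballP[e /= e0 eA]; apply/(@nbhs_ballP _ R[i]^o).
exists e%:C => /=; first by rewrite ltcR.
move=> t zt; apply: eA; rewrite -ball_normE /= -ltcR; apply: le_lt_trans zt.
rewrite -raddfB -normrN -ReiNIm; apply: (le_trans (normc_ge_Re _)).
by rewrite normrM [X in _ * X]normc_def /= expr0n expr1n add0r sqrtr1 mulr1.
Qed.

Lemma real_complex_continuous :
  continuous (fun x : R^o => x%:C : R[i]^o).
Proof.
move=> x A /(@nbhs_ballP _ R[i]^o)[[e e'] /= /[!ltcE]/= /andP[/eqP -> e0] eA].
apply/nbhs_ballP; exists e => //= t; rewrite -ball_normE /= => xt.
by apply: eA; rewrite -ball_normE /= -raddfB normc_def /= expr0n addr0 sqrtr_sqr ltcR.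
Qed.

Lemma expi_continuous : continuous expi.
Proof.
move=> x; apply: (@continuous_comp_initial circle R^o R[i]^o val expi) => {}x.
have -> : val \o expi =
    (fun y => (cos y)%:C + 'i%C * (sin y)%:C : R[i]^o).
  by apply/funext => y; rewrite /= [LHS]complexE.
apply: (@cvgD R[i] R[i]^o R^o).
  apply: continuous_comp; first exact: continuous_cos.
  exact: real_complex_continuous.
apply: (@cvgMr R[i] R^o).
apply: continuous_comp; first exact: continuous_sin.
exact: real_complex_continuous.
Qed.

Lemma circle_compact : compact [set: circle].
Proof.
have -> : [set: circle] = [set expi x | x in `[- pi, pi]].
  apply/seteqP; split=> // z _; have [y [-> ypi _]] := circle_polar 0 z.
  by exists y => //; rewrite add0r.
apply: continuous_compact; last exact: segment_compact.
exact/continuous_subspaceT/expi_continuous.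
Qed.

Section arc.
Variables (a b : R) (ab : 0 < b - a < pi *+ 2).

Definition arc : set circle := [set expi x | x in [set x | a < x < b]].

Definition arc_le (z w : circle) : Prop :=
  exists x y, [/\ a < x < b, a < y < b, z = expi x, w = expi y & x <= y].

Lemma arc_le_supp z w : arc_le z w -> arc z /\ arc w.
Proof. by move=> [x [y [xab yab -> -> _]]]; split; [exists x|exists y]. Qed.

Lemma arc_le_refl z : arc z -> arc_le z z.
Proof. by move=> [x xab <-]; exists x, x. Qed.

Lemma arc_le_anti z w : arc_le z w -> arc_le w z -> z = w.
Proof.
move=> [x [y [xab yab -> -> xy]]] [y' [x' [yab' xab' ey ex yx]]].
have ? := expi_inj ab xab xab' ex; have ? := expi_inj ab yab yab' ey.
by subst x' y'; congr expi; apply/eqP; rewrite eq_le xy yx.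
Qed.

Lemma arc_le_trans z w v : arc_le z w -> arc_le w v -> arc_le z v.
Proof.
move=> [x [y [xab yab -> -> xy]]] [y' [t [yab' tab' ey -> yt]]].
have ? := expi_inj ab yab yab' ey; subst y'.
by exists x, t; split=> //; exact: le_trans yt.
Qed.

Definition arc_oset : oset circle :=
  OSet arc_le_supp arc_le_refl arc_le_anti arc_le_trans.

Let m := (a + b) / 2.
Let h := (b - a) / 2.

Lemma arcE : arc = [set z | cos h < complex.Re (val z) * cos m
                              + complex.Im (val z) * sin m].
Proof.
have [h0 hpi] : 0 < h /\ h < pi.
  move: ab => /andP[ab0 abpi]; split; first by rewrite divr_gt0.
  by rewrite ltr_pdivrMr// mulr_natr.
have [mh mh'] : m - h = a /\ m + h = b by rewrite /m /h; split; field.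
apply/seteqP; split=> [_ [x /= /andP[ax xb] <-] /=|z /= zh].
  rewrite -cosB -(cos_norm (x - m)).
  have xm : `|x - m| < h by rewrite ltr_norml; apply/andP; split; lra.
  rewrite ltr_cos// ?in_itv/= ?normr_ge0/=; last by rewrite (ltW hpi) (ltW h0).
  exact: ltW (lt_trans xm hpi).
have [y [zE ypi cy]] := circle_polar m z; exists (m + y); last exact: esym zE.
move: zh; rewrite -cy -(cos_norm y) ltr_cos ?in_itv/= ?normr_ge0 ?ler_norml//=;
  last by rewrite (ltW hpi) (ltW h0).
by rewrite ltr_norml => /andP[? ?]; apply/andP; split; lra.
Qed.

Lemma arc_open : open arc.
Proof.
rewrite arcE.
pose f : circle -> R^o := fun z =>
  complex.Re (val z) * cos m + complex.Im (val z) * sin m.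
have cRe : continuous (fun z : circle => complex.Re (val z) : R).
  by move=> z; exact: (continuous_comp (@val_circle_continuous z) (@Re_continuous _)).
have cIm : continuous (fun z : circle => complex.Im (val z) : R).
  by move=> z; exact: (continuous_comp (@val_circle_continuous z) (@Im_continuous _)).
have cf : continuous f.
  move=> z; apply: (@continuousD _ R^o circle).
    exact: (@continuousM R circle _ _ z (cRe z) (@cst_continuous _ _ _ z)).
  exact: (@continuousM R circle _ _ z (cIm z) (@cst_continuous _ _ _ z)).
rewrite (_ : [set _ | _] = f @^-1` [set x | cos h < x])//.
by move/continuousP: cf; apply; exact: open_gt.
Qed.

End arc.

Definition arcs : set (oset circle) :=
  [set A | exists a b (ab : 0 < b - a < pi *+ 2), A = arc_oset ab].

Lemma arc_around_subproof x d : 0 < d < pi ->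
  0 < (x + d) - (x - d) < pi *+ 2.
Proof. by move=> /andP[? ?]; apply/andP; split; lra. Qed.

Definition arc_around x d (d0 : 0 < d < pi) : oset circle :=
  arc_oset (arc_around_subproof x d0).

Lemma arc_around_mem x d (d0 : 0 < d < pi) : carrier (arc_around x d0) (expi x).
Proof. by exists x => //=; lra. Qed.

Lemma arcs_around x d (d0 : 0 < d < pi) : arcs (arc_around x d0).
Proof. by do 3!eexists. Qed.

Lemma arc_around_lax x y d (d0 : 0 < d < pi) : expi x = expi y ->
  sub_lax (arc_around x d0) (arc_around y d0).
Proof.
move=> xy; have yE t : expi t = expi (y + (t - x)).
  by rewrite -(expiDl (t - x) xy); congr expi; lra.
split=> [_ [t /= xt <-]|_ _ [t [s /= [xt xs -> -> ts]]]].
  by exists (y + (t - x)) => //=; lra.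
by exists (y + (t - x)), (y + (s - x)); split=> //; lra.
Qed.

Lemma arc_around_str a b (ab : 0 < b - a < pi *+ 2) x d (d0 : 0 < d < pi) :
  a <= x - d -> x + d <= b -> sub_str (arc_around x d0) (arc_oset ab).
Proof.
move=> ad db; split=> [_ [t /= xt <-]|_ _ [t /= xt <-] [s /= xs <-]].
  by exists t => //=; lra.
split=> -[t' [s' [t'P s'P et es ts]]].
  by exists t', s'; split=> //; lra.
have tab : a < t < b by lra.
have sab : a < s < b by lra.
have ? := expi_inj ab tab t'P et; have ? := expi_inj ab sab s'P es.
by subst t' s'; exists t, s; split.
Qed.

Lemma arcs_near (z : circle) (U : set circle) : open U -> U z ->
  exists x e, [/\ z = expi x, 0 < e < pi &
    forall d (d0 : 0 < d < pi), d <= e -> carrier (arc_around x d0) `<=` U].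
Proof.
move=> oU; have [x ->] := expi_surj z => Uz.
have : nbhs x (expi @^-1` U).
  by apply: expi_continuous; exact: open_nbhs_nbhs.
move=> /nbhs_ballP[e /= e0 eU]; have p0 := pi_gt0 R.
exists x, (Num.min e (pi / 2)); split=> //.
  rewrite lt_min e0 divr_gt0//= gt_min; apply/orP; right; lra.
move=> d d0; rewrite le_min => /andP[de _] _ [t /= xt <-].
by apply: eU; rewrite -ball_normE /= ltr_norml; lra.
Qed.

Lemma arcs_inter (z : circle) A B : arcs A -> arcs B ->
  carrier A z -> carrier B z ->
  exists C, [/\ arcs C, carrier C z, sub_str C A & sub_str C B].
Proof.
move=> [a [b [ab ->]]] [a' [b' [ab' ->]]] [x /= xab <-] [y /= yab yx].
have p0 := pi_gt0 R.
pose d := Num.min (Num.min (x - a) (b - x)) (Num.min (Num.min (y - a') (b' - y)) (pi / 2)).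
have [d0 [da db] [da' db'] dp] : [/\ 0 < d, d <= x - a /\ d <= b - x,
    d <= y - a' /\ d <= b' - y & d <= pi / 2].
  by split; [rewrite !lt_min; lra|rewrite !ge_min !lexx ?orbT..].
have dP : 0 < d < pi by lra.
exists (arc_around x dP); split.
- exact: arcs_around.
- exact: arc_around_mem.
- by apply: arc_around_str; lra.
- have [sB oB] : sub_str (arc_around y dP) (arc_oset ab').
    by apply: arc_around_str; lra.
  have [s1 o1] := arc_around_lax dP (esym yx).
  have [s2 o2] := arc_around_lax dP yx.
  split=> [p /s1/sB//|p q xp xq]; split=> [/o1 pq|pq].
    by apply/oB => //; exact: s1.
  by apply/o2/oB => //; exact: s1.
Qed.

Lemma arcs_ordered_basis : ordered_basis arcs.
Proof.
apply/ordered_basisP; split.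
- by move=> _ [a [b [ab ->]]]; exact: arc_open.
- move=> z U oU Uz; have [x [e [-> e0 eU]]] := arcs_near oU Uz.
  exists (arc_around x e0); split; first exact: arcs_around.
    exact: arc_around_mem.
  exact: eU.
- move=> z A B cA cB Az Bz; have [C [? ? /sub_str_lax ? /sub_str_lax ?]] :=
    arcs_inter cA cB Az Bz.
  by exists C.
Qed.

Definition directed_circle : loSpace := lo_of_basis arcs_ordered_basis.

Section eq_oset.
Variables (T : Type) (A : set T).

Definition eq_le (p q : T) := A p /\ p = q.

Lemma eq_le_supp p q : eq_le p q -> A p /\ A q.
Proof. by move=> [? <-]. Qed.

Lemma eq_le_refl p : A p -> eq_le p p.
Proof. by []. Qed.

Lemma eq_le_anti p q : eq_le p q -> eq_le q p -> p = q.
Proof. by move=> []. Qed.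

Lemma eq_le_trans p q r : eq_le p q -> eq_le q r -> eq_le p r.
Proof. by move=> [? <-]. Qed.

Definition eq_oset : oset T := OSet eq_le_supp eq_le_refl eq_le_anti eq_le_trans.

End eq_oset.

Definition unordered_arcs : set (oset circle) :=
  [set eq_oset (carrier A) | A in arcs].

Lemma unordered_arcs_ordered_basis : ordered_basis unordered_arcs.
Proof.
have /ordered_basisP [oA bA iA] := arcs_ordered_basis.
apply/ordered_basisP; split.
- by move=> _ [A cA <-]; exact: (oA A cA).
- move=> z U oU Uz; have [A [cA Az AU]] := bA z U oU Uz.
  by exists (eq_oset (carrier A)); split=> //; exists A.
- move=> z _ _ [A cA <-] [B cB <-] Az Bz.
  have [C [cC Cz [CA _] [CB _]]] := iA z A B cA cB Az Bz.
  exists (eq_oset (carrier C)); split=> //; first by exists C.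
  + by split=> [//|p q [/CA ? <-]]; split.
  + by split=> [//|p q [/CB ? <-]]; split.
Qed.

Definition unordered_circle : loSpace := lo_of_basis unordered_arcs_ordered_basis.

End circle.

Arguments circle : clear implicits.
Arguments arcs : clear implicits.

Section parallel_pair.
Variables (R : realType) (X : loSpace) (pt : X).

Definition circle1 : circle R := exist _ (1 : R[i]^o) (mem_set (normr1 R[i])).

Definition i_fun (s : circle R) : circle R * X := (s, pt).

Definition c_fun (s : circle R) : circle R * X := (circle1, pt).

Lemma i_funP (s : unordered_circle R) :
  @locally_increasing_at (unordered_circle R)
    (lo_prod (directed_circle R) X) i_fun s.
Proof.
apply: locally_increasing_atP; [exact: lo_of_basis_class..|].
move=> _ [A OA [B OB <-]] [/= As Bpt].
have [C [cC Cs [CA oCA]]] := OA _ (lo_of_basis_class _) s As.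
exists (eq_oset (carrier C)); split=> //; first by exists C.
- by move=> _ [t /CA At <-].
- by move=> t _ [/CA At <-]; split; exact: ole_refl.
Qed.

Lemma c_funP (s : unordered_circle R) :
  @locally_increasing_at (unordered_circle R)
    (lo_prod (directed_circle R) X) c_fun s.
Proof.
apply: locally_increasing_atP; [exact: lo_of_basis_class..|].
move=> _ [A OA [B OB <-]] [/= A1 Bpt].
have /ordered_basisP[_ /(_ s setT openT I) [C [cC Cs _]] _] :=
  unordered_arcs_ordered_basis R.
exists C; split=> //; first by move=> _ [t _ <-].
by move=> t u _; split; exact: ole_refl.
Qed.

Definition i_map : loHom (unordered_circle R) (lo_prod (directed_circle R) X) :=
  LoHom i_funP.

Definition c_map : loHom (unordered_circle R) (lo_prod (directed_circle R) X) :=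
  LoHom c_funP.

End parallel_pair.

(* The codomain of f with its final topology, dually to [initial_topology]. *)
Definition final_topology {S T : Type} (f : S -> T) : Type := T.

Section final_topology.
Variables (S : topologicalType) (T : choiceType) (f : S -> T).
Local Notation W := (final_topology f).

Definition final_open : set_system W := [set U | open (f @^-1` U)].

Lemma final_openT : final_open setT.
Proof. by rewrite /final_open /= preimage_setT; exact: openT. Qed.

Lemma final_openI : setI_closed final_open.
Proof. by move=> U V oU oV; exact: openI. Qed.

Lemma final_open_bigU (I : Type) (g : I -> set W) :
  (forall i, final_open (g i)) -> final_open (\bigcup_i g i).
Proof. by move=> og; apply: bigcup_open => i _; exact: og. Qed.

HB.instance Definition _ := Choice.on W.
HB.instance Definition _ :=
  isOpenTopological.Build W final_openT final_openI final_open_bigU.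

End final_topology.

Section X_O.
Variables (R : realType) (X : loSpace) (O : set X).

Definition XO_type : Type := (set_type O + circle R * set_type (~` O))%type.

HB.instance Definition _ :=
  Choice.copy XO_type (set_type O + circle R * set_type (~` O))%type.

Definition q_fun (p : circle R * X) : XO_type :=
  match pselect (O p.2) with
  | left Ot => inl (exist _ p.2 (mem_set Ot))
  | right NOt => inr (p.1, exist _ p.2 (mem_set NOt))
  end.

Definition XO_top : topologicalType := final_topology q_fun.

Section U_oset.
Variables (alpha : oset (circle R)) (A : oset X).

Definition U_gen (u v : XO_top) : Prop :=
  exists p p', [/\ ole (oset_prod alpha A) p p', q_fun p = u & q_fun p' = v].

Definition U_carrier : set XO_top :=
  [set q_fun p | p in carrier alpha `*` carrier A].

Definition U_le : XO_top -> XO_top -> Prop := clos_trans XO_top U_gen.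

Definition XO_snd (u : XO_type) : X :=
  match u with inl t => val t | inr st => val st.2 end.

Lemma q_fun_snd p : XO_snd (q_fun p) = p.2.
Proof. by rewrite /q_fun; case: pselect. Qed.

Lemma q_fun_eq_snd p p' : q_fun p = q_fun p' -> p.2 = p'.2.
Proof. by move=> /(congr1 XO_snd); rewrite !q_fun_snd. Qed.

Lemma q_fun_inl p (t : set_type O) : q_fun p = inl t -> p.2 = val t.
Proof. by move=> e; rewrite -q_fun_snd e. Qed.

Lemma q_fun_inr p st : q_fun p = inr st -> p.1 = st.1 /\ p.2 = val st.2.
Proof. by rewrite /q_fun; case: pselect => // NOt [<-]. Qed.

Lemma q_fun_in s s' t : O t -> q_fun (s, t) = q_fun (s', t).
Proof. by rewrite /q_fun /=; case: pselect. Qed.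

Lemma U_le_supp u v : U_le u v -> U_carrier u /\ U_carrier v.
Proof.
elim=> {u v} [u v [p [p' [pp' <- <-]]]|u v w _ [uu _] _ [_ ww]] //.
by have [? ?] := ole_supp pp'; split; [exists p|exists p'].
Qed.

Lemma U_le_refl u : U_carrier u -> U_le u u.
Proof.
by move=> [p Up <-]; apply: t_step; exists p, p; split=> //; exact: ole_refl.
Qed.

Lemma U_le_trans u v w : U_le u v -> U_le v w -> U_le u w.
Proof. exact: t_trans. Qed.

Lemma U_le_snd u v : U_le u v -> ole A (XO_snd u) (XO_snd v).
Proof.
elim=> {u v} [u v [p [p' [[_ pp'] <- <-]]]|u v w _ uv _ vw].
  by rewrite !q_fun_snd.
exact: ole_trans vw.
Qed.

(* Along a chain with constant second projection t, nothing happens when t is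
   in O and the first projection is increasing otherwise. *)
Lemma U_le_fst u v : U_le u v -> XO_snd u = XO_snd v ->
  match u, v with
  | inl t, inl t' => t = t'
  | inr (s, t), inr (s', t') => ole alpha s s' /\ t = t'
  | _, _ => False
  end.
Proof.
elim=> {u v} [u v [p [p' [[pp1 pp2] pu pv]]] uv|u v w uv IHuv vw IHvw uw].
  have e2 : p.2 = p'.2 by rewrite -!q_fun_snd pu pv.
  case: u v pu pv uv => [t|[s t]] [t'|[s' t']].
  - by move=> _ _ /= /val_inj.
  - move=> /q_fun_inl pt /q_fun_inr[_ /= pt'] _.
    have /set_mem Ot := valP t; have /set_mem /= NOt' := valP t'.
    by apply: NOt'; rewrite -pt' -e2 pt.
  - move=> /q_fun_inr[_ /= pt'] /q_fun_inl pt _.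
    have /set_mem Ot := valP t'; have /set_mem /= NOt' := valP t.
    by apply: NOt'; rewrite -pt' e2 pt.
  - move=> /q_fun_inr[/= <- _] /q_fun_inr[/= <- _] /= /val_inj ?.
    by split.
have e : XO_snd u = XO_snd v.
  apply: (ole_anti (U_le_snd uv)); rewrite uw; exact: U_le_snd vw.
have e' : XO_snd v = XO_snd w by rewrite -e.
move: (IHuv e) (IHvw e'); case: u v w {uv IHuv vw IHvw uw e e'} =>
  [t|[s t]] [t'|[s' t']] [t''|[s'' t'']] //.
  by move=> ->.
by move=> [ss' ->] [s's'' ->]; split=> //; exact: ole_trans s's''.
Qed.

Lemma U_le_anti u v : U_le u v -> U_le v u -> u = v.
Proof.
move=> uv vu; have e := ole_anti (U_le_snd uv) (U_le_snd vu).
move: (U_le_fst uv e) (U_le_fst vu (esym e)).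
case: u v {uv vu e} => [t|[s t]] [t'|[s' t']] //; first by move=> ->.
by move=> [ss' ->] [s's _]; rewrite (ole_anti ss' s's).
Qed.

Definition U_oset : oset XO_top :=
  OSet U_le_supp U_le_refl U_le_anti U_le_trans.

End U_oset.

Definition XO_basis : set (oset XO_top) :=
  [set U_oset alpha A | alpha in arcs R & A in open_posets X].

Lemma U_oset_lax alpha alpha' A A' :
  sub_lax alpha alpha' -> sub_lax A A' ->
  sub_lax (U_oset alpha A) (U_oset alpha' A').
Proof.
move=> [sa oa] [sA oA]; split=> [_ [p [pa pA] <-]|u v].
  by exists p => //; split; [exact: sa|exact: sA].
elim=> {u v} [u v [p [p' [[p1 p2] <- <-]]]|u v w _ uv _ vw].
  by apply: t_step; exists p, p'; split=> //; split; [exact: oa|exact: oA].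
exact: t_trans uv vw.
Qed.

Lemma U_oset_lax_in alpha alpha' A A' :
  carrier alpha' !=set0 -> carrier A `<=` O -> sub_lax A A' ->
  sub_lax (U_oset alpha A) (U_oset alpha' A').
Proof.
move=> [s0 s0P] AO [sA oA].
have qE s t : carrier A t -> q_fun (s, t) = q_fun (s0, t).
  by move=> /AO Ot; exact: q_fun_in.
split=> [_ [[s t] [/= pa pA] <-]|u v].
  by exists (s0, t); [split=> //; exact: sA|rewrite -(qE s)].
elim=> {u v} [u v [[s t] [[s' t'] [[/= p1 p2] <- <-]]]|u v w _ uv _ vw].
  have [At At'] := ole_supp p2; apply: t_step.
  exists (s0, t), (s0, t').
  split; [|exact: esym (qE s t At)|exact: esym (qE s' t' At')].
  by split; [exact: ole_refl|exact: oA].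
exact: t_trans uv vw.
Qed.

Hypothesis oO : open O.

Lemma q_fun_inlE s (t : set_type O) : q_fun (s, val t) = inl t.
Proof.
rewrite /q_fun /=; case: pselect => [Ot|NOt]; first by congr inl; exact: val_inj.
by have /set_mem := valP t.
Qed.

Lemma q_fun_inrE s (t : set_type (~` O)) : q_fun (s, val t) = inr (s, t).
Proof.
rewrite /q_fun /=; case: pselect => [Ot|NOt]; first by have /set_mem := valP t.
by congr (inr (_, _)); exact: val_inj.
Qed.

Lemma arcs_nonempty (alpha : oset (circle R)) : arcs R alpha -> carrier alpha !=set0.
Proof.
move=> [a [b [ab ->]]]; have /andP[ab0 _] := ab; exists (expi ((a + b) / 2)).
by exists ((a + b) / 2) => //=; lra.
Qed.

Lemma U_carrier_open alpha A : arcs R alpha -> open_posets X A ->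
  open (U_carrier alpha A).
Proof.
move=> ca OA.
have /ordered_basisP[oX _ _] := @open_posets_ordered_basis X.
have [s0 as0] := arcs_nonempty ca.
have /ordered_basisP[oP _ _] :=
  prod_ordered_basis (arcs_ordered_basis R) (@open_posets_ordered_basis X).
suff : open (q_fun @^-1` U_carrier alpha A) by [].
have -> : q_fun @^-1` U_carrier alpha A =
    (carrier alpha `*` carrier A) `|` (snd @^-1` (O `&` carrier A)).
  apply/seteqP; split=> [[s t] [[s' t'] [/= as' At'] e]|[s t] [[/= ? ?]|[/= Ot At]]].
  - have /= tt' := q_fun_eq_snd e.
    rewrite {}tt' in At' e; have [Ot|NOt] := pselect (O t); first by right.
    left; split=> //=; move: e; rewrite /q_fun /=; case: pselect => // ? [<-].
    done.
  - by exists (s, t).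
  - by exists (s0, t) => //; exact: q_fun_in.
apply: openU.
  by apply: (oP (oset_prod alpha A)); exists alpha => //; exists A.
have /continuousP : continuous (snd : circle R * X -> X).
  by move=> p; exact: cvg_snd.
apply; by apply: openI => //; exact: oX.
Qed.

Lemma XO_ordered_basis : ordered_basis XO_basis.
Proof.
have bX := @open_posets_ordered_basis X.
have /ordered_basisP[oP bP _] := prod_ordered_basis (arcs_ordered_basis R) bX.
have /ordered_basisP[_ bA iA] := arcs_ordered_basis R.
have {bX} /ordered_basisP[oX bX iX] := bX.
have [alpha0 [ca0 _ _]] := bA (circle1 R) setT openT I.
have [s0 as0] := arcs_nonempty ca0.
apply/ordered_basisP; split.
- by move=> _ [alpha ca [A OA <-]]; exact: U_carrier_open.
- move=> u W oW Wu; have {}oW : open (q_fun @^-1` W) by [].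
  case: u Wu => [t|[s t]] Wu.
    have /set_mem Ot := valP t.
    have : nbhs (val t) [set t' | [set: circle R] `<=`
        (fun s => (W : set XO_type) (q_fun (s, t')))].
      move/compact_near_coveringP : (@circle_compact R) => cov.
      apply: (cov X (nbhs (val t))) => s _.
      have : nbhs (s, val t) (q_fun @^-1` W).
        by apply: open_nbhs_nbhs; split=> //=; rewrite q_fun_inlE.
      by apply: filterS => -[].
    rewrite nbhsE => -[V [oV Vt] VW].
    have [A [OA At AV]] := bX (val t) V oV Vt.
    exists (U_oset alpha0 A); split; first by exists alpha0 => //; exists A.
      by exists (s0, val t) => //; exact: q_fun_inlE.
    by move=> _ [[s' t'] [/= _ /AV/VW H] <-]; exact: H.
  have [_ [[alpha ca [A OA <-]] [/= as_ At] aAW]] :=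
    bP (s, val t) (q_fun @^-1` W) oW (eq_ind_r (W : set XO_type) Wu (q_fun_inrE s t)).
  exists (U_oset alpha A); split; first by exists alpha => //; exists A.
    by exists (s, val t) => //; exact: q_fun_inrE.
  by move=> _ [p /aAW Wp <-].
- move=> u _ _ [alpha ca [A OA <-]] [beta cb [B OB <-]].
  move=> [[s t] [/= as_ At] <-] [[s' t'] [/= bs' Bt'] e].
  have /= tt' := q_fun_eq_snd e.
  rewrite {}tt' in Bt' e; have [C [OC Ct CA CB]] := iX t A B OA OB At Bt'.
  have [Ot|NOt] := pselect (O t).
    have [D [OD Dt DO]] := bX t O oO Ot.
    have [E [OE Et EC [ED _]]] := iX t C D OC OD Ct Dt.
    exists (U_oset alpha E); split; first by exists alpha => //; exists E.
    + by exists (s, t).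
    + apply: U_oset_lax_in; first exact: arcs_nonempty.
        exact: subset_trans DO.
      exact: sub_lax_trans CA.
    + apply: U_oset_lax_in; first exact: arcs_nonempty.
        exact: subset_trans DO.
      exact: sub_lax_trans CB.
  have ss' : s' = s by move: e; rewrite /q_fun /=; case: pselect => // ? [].
  rewrite {}ss' in bs' e.
  have [gamma [cg gs ga gb]] := iA s alpha beta ca cb as_ bs'.
  exists (U_oset gamma C); split; first by exists gamma => //; exists C.
  + by exists (s, t).
  + exact: U_oset_lax.
  + exact: U_oset_lax.
Qed.

Definition XO : loSpace := lo_of_basis XO_ordered_basis.

Lemma q_funP p : @locally_increasing_at (lo_prod (directed_circle R) X) XO q_fun p.
Proof.
apply: locally_increasing_atP; [exact: lo_of_basis_class..|].
move=> _ [alpha ca [A OA <-]] [[s t] [/= as_ At] e].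
case: p e => s' t' e.
have /= tt' := q_fun_eq_snd e.
rewrite -{}tt' in e *.
have arcO : arcs R `<=` open_posets (directed_circle R).
  by apply: (@lo_class_open_posets (directed_circle R)); exact: lo_of_basis_class.
have [Ot|NOt] := pselect (O t).
  have /ordered_basisP[_ bX iX] := @open_posets_ordered_basis X.
  have /ordered_basisP[_ bA _] := arcs_ordered_basis R.
  have [D [OD Dt DO]] := bX t O oO Ot.
  have [E [OE Et EA [ED _]]] := iX t A D OA OD At Dt.
  have [beta [cb bs' _]] := bA s' setT openT I.
  have [sE oE] : sub_lax (U_oset beta E) (U_oset alpha A).
    apply: U_oset_lax_in => //; first exact: arcs_nonempty.
    exact: subset_trans DO.
  exists (oset_prod beta E); split=> //; first by exists beta; [exact: arcO|exists E].
  by move=> p1 p2 p12; apply: oE; apply: t_step; exists p1, p2.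
have ss' : s' = s by move: e; rewrite /q_fun /=; case: pselect => // ? [].
rewrite {}ss'; exists (oset_prod alpha A); split=> //.
- by exists alpha; [exact: arcO|exists A].
- by move=> p1 p2 p12; apply: t_step; exists p1, p2.
Qed.

Definition q_map : loHom (lo_prod (directed_circle R) X) XO := LoHom q_funP.

End X_O.

Definition smallest_clopen_nbhs (X : topologicalType) (x : X) (O : set X) : Prop :=
  [/\ clopen O, O x & forall U, clopen U -> U x -> O `<=` U].

(* Main.v *)
From Stdlib Require Import Relation_Operators.
From mathcomp Require Import all_boot all_order all_algebra complex lra.
From mathcomp Require Import all_classical all_reals all_analysis.
Require Import Defs.
Set Implicit Arguments.
Unset Strict Implicit.
Unset Printing Implicit Defensive.
Import Order.TTheory GRing.Theory Num.Theory numFieldNormedType.Exports.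
Local Open Scope classical_set_scope.
Local Open Scope ring_scope.
Local Open Scope complex_scope.

(** Call a map [h] from [directed circle x X] to a Hausdorff locally ordered
    space [Y] constant over [t] if [s |-> h (s, t)] is constant, and let [Z] be
    the set of these [t] ([cst_fibers]).  The whole theorem rests on [Z] being
    clopen.

    - [Z] is closed because [Y] is Hausdorff ([cst_fibers_closed]).
    - [Z] is open because a locally increasing map from the directed circle to
      a poset is constant: lifted to the real line it is increasing and
      periodic ([locally_increasing_circle_cst]).  If [h] is constant over [t],
      compactness of the circle provides a neighbourhood of [t] over which [h]
      is, around each point of the circle, increasing into one and the same
      open poset of [Y] ([cst_fibers_open]).

    If [O] is clopen, [X_O] is the disjoint sum of [O] and of the product of
    the directed circle with the complement of [O], both as a topological space
    and for the order: an open poset of [X] contained in [O], or in its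
    complement, gives rise to a poset of [X_O] that is a copy of it, or its
    product with an arc ([U_le_in], [U_le_out]).  So [X_O] inherits from [X]
    each of the properties that define the four categories ([XO_objects]).

    A map [h] that coequalizes the two maps out of the circle is constant over
    the base point.  If there is a smallest clopen neighbourhood [O] of that
    point, then [O] is contained in [Z], hence [h] factors through [q_O], and
    uniquely so since [q_O] is surjective ([q_map_coequalizer]).
    Conversely, let [q] be a coequalizer.  For every clopen neighbourhood [U]
    of the base point, [X_U] is an object of the category, so that [q_U] factors
    through [q]; wherever [q] is constant, [q_U] is constant as well, and this
    only happens over [U].  The clopen set of the points over which [q] is
    constant is therefore contained in every such [U]
    ([coequalizer_smallest_clopen_nbhs]). *)

(** * Bases, morphisms and products of locally ordered spaces *)

Lemma cluster_image (S T : topologicalType) (f : S -> T) (p q : S) :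
  hausdorff_space T -> continuous f -> cluster (nbhs p) q -> f p = f q.
Proof.
move=> hT cf pq; apply: hT => A B /cf fA /cf fB.
by have [x [Ax Bx]] := pq _ _ fA fB; exists (f x).
Qed.

Lemma circle_hausdorff (R : realType) : hausdorff_space (circle R).
Proof.
move=> p q pq; apply: val_inj; apply: cluster_image pq; first exact: norm_hausdorff.
exact: val_circle_continuous.
Qed.

Lemma loHom_eq (X Y : loSpace) (f g : loHom X Y) : (forall x, f x = g x) -> f = g.
Proof.
case: f g => [f fP] [g gP] /= /funext fg; subst g.
by congr LoHom; exact: Prop_irrelevance.
Qed.

(** This criterion avoids checking the axioms of an ordered basis each time a
    basis of a locally ordered space is replaced by a smaller one. *)
Lemma lo_class_refine (X : loSpace) (G : set (oset X)) :
  G `<=` open_posets X -> coarser (open_posets X) G -> lo_class G.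
Proof.
move=> GO cG.
have /ordered_basisP[oX bX iX] := @open_posets_ordered_basis X.
have oG : ordered_basis G.
  apply/ordered_basisP; split.
  - by move=> A /GO; exact: oX.
  - move=> x U oU Ux; have [A [OA Ax AU]] := bX x U oU Ux.
    have [B [GB Bx [BA _]]] := cG x A OA Ax.
    by exists B; split=> //; exact: subset_trans AU.
  - move=> x A B /GO OA /GO OB Ax Bx.
    have [D [OD Dx DA DB]] := iX x A B OA OB Ax Bx.
    have [E [GE Ex ED]] := cG x D OD Dx.
    by exists E; split=> //; [exact: sub_lax_trans DA|exact: sub_lax_trans DB].
have [F0 b0 e] := lo_classP X.
have cF0 : lo_class F0 by rewrite e; split=> //; split; exact: coarser_refl.
rewrite e; split=> //; split; last by move=> x A /GO OA; exact: OA.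
by move=> x A /(lo_class_open_posets cF0); exact: cG.
Qed.

Lemma open_posets_class (X : loSpace) : @lo_class X (open_posets X).
Proof. by apply: lo_class_refine => //; exact: coarser_refl. Qed.

Lemma prod_coarser (X Y : topologicalType) (F1 F2 : set (oset X))
    (G1 G2 : set (oset Y)) :
  coarser F1 F2 -> coarser G1 G2 ->
  coarser (prod_basis F1 G1) (prod_basis F2 G2).
Proof.
move=> cF cG [x y] _ [A FA [B GB <-]] [/= Ax By].
have [A' [FA' A'x AA']] := cF x A FA Ax.
have [B' [GB' B'y BB']] := cG y B GB By.
exists (oset_prod A' B'); split=> //; last exact: oset_prod_lax.
by exists A' => //; exists B'.
Qed.

(** This allows to test morphisms out of a product with the directed circle on
    arcs times open posets. *)
Lemma lo_prod_class (X Y : loSpace) (F : set (oset X)) (G : set (oset Y)) :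
  lo_class F -> lo_class G -> @lo_class (lo_prod X Y) (prod_basis F G).
Proof.
move=> cF cG; split.
  by apply: prod_ordered_basis; exact: lo_class_basis.
by split; apply: prod_coarser; apply: lo_class_coarser => //;
  exact: open_posets_class.
Qed.

Lemma loHom_open_poset (X Y : loSpace) (f : loHom X Y) (F : set (oset X))
    (x : X) (B : oset Y) :
  lo_class F -> open_posets Y B -> carrier B (f x) ->
  exists A, [/\ F A, carrier A x, forall p, carrier A p -> carrier B (f p) &
    forall p q, ole A p q -> ole B (f p) (f q)].
Proof.
move=> cF OB Bfx.
have [A [FA Ax AB oAB]] := lo_funP cF (open_posets_class Y) OB Bfx.
by exists A; split=> // p Ap; apply: AB; exists p.
Qed.

Lemma loHom_continuous (X Y : loSpace) (f : loHom X Y) : continuous f.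
Proof.
have /ordered_basisP[oX _ _] := @open_posets_ordered_basis X.
have /ordered_basisP[_ bY _] := @open_posets_ordered_basis Y.
move=> x U; rewrite /= nbhsE => -[V [oV Vx] VU].
have [B [OB Bfx BV]] := bY _ _ oV Vx.
have [A [OA Ax AB _]] := loHom_open_poset (open_posets_class X) OB Bfx.
have : nbhs x (carrier A) by apply: open_nbhs_nbhs; split=> //; exact: oX.
by apply: filterS => p /AB/BV/VU.
Qed.

(** * Locally increasing maps on the directed circle *)

(** The points [w] such that [g] stays above [g y] all the way from [y] to [w]
    have a supremum; local monotonicity around it carries them as far as [z]. *)
Lemma locally_increasing_le (R : realType) (T : Type) (B : oset T) (g : R -> T) :
  (forall x, exists2 e, 0 < e &
     forall y z, x - e < y -> y <= z -> z < x + e -> ole B (g y) (g z)) ->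
  forall y z, y <= z -> ole B (g y) (g z).
Proof.
move=> loc y z yz.
pose S := [set w | y <= w <= z /\ forall v, y <= v <= w -> ole B (g y) (g v)].
suff : S z by move=> [_]; apply; rewrite yz lexx.
have Sy : S y.
  split=> [|v vy]; first by rewrite lexx.
  have -> : v = y by apply/le_anti; rewrite andbC.
  by have [e e0 /(_ y y)] := loc y; apply; lra.
have Sz : ubound S z by move=> w [/andP[]].
have supS : has_sup S by split; [exists y|exists z].
have [e e0 ce] := loc (sup S).
have [w Sw ew] := sup_adherent e0 supS.
have wc := sup_upper_bound supS Sw.
have yw : y <= w by case: Sw => /andP[].
have Sv v : S w -> w <= v -> v <= z -> v < sup S + e -> S v.
  move=> [_ Sw'] wv vz ve; split=> [|u /andP[yu uv]]; first by rewrite vz (le_trans yw).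
  have [uw|/ltW wu] := leP u w; first by apply: Sw'; rewrite yu.
  apply: (ole_trans (Sw' w _)); first by rewrite yw lexx.
  by apply: ce => //; apply: le_lt_trans ve.
have [zc|cz] := ltP z (sup S + e).
  by apply: (Sv z) => //; exact: Sz.
have : S (sup S + e / 2) by apply: Sv => //; lra.
by move=> /(sup_upper_bound supS); lra.
Qed.

Section circle.
Variable R : realType.

Lemma expiD2pi (x : R) : expi (x + pi *+ 2) = expi x.
Proof. by apply/expi_eq; rewrite cosD2pi sinD2pi. Qed.

(** A directed loop in a poset is trivial: along the real line [g] increases,
    and it takes the same value after a full turn, so that each of two points
    of the circle is mapped above the other. *)
Lemma locally_increasing_circle_cst (T : Type) (B : oset T) (g : circle R -> T) :
  (forall s, exists alpha, [/\ arcs R alpha, carrier alpha s &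
     forall p q, ole alpha p q -> ole B (g p) (g q)]) ->
  forall s s', g s = g s'.
Proof.
move=> loc s s'.
have mono (y z : R) : y <= z -> ole B (g (expi y)) (g (expi z)).
  apply: (@locally_increasing_le _ _ _ (g \o @expi R)) => x.
  have [alpha [[a [b [ab ->]]] [x0 /= x0ab x0x] incr]] := loc (expi x).
  have shift t : expi t = expi (x0 + (t - x)).
    by rewrite (expiDl _ x0x); congr expi; lra.
  (* The largest radius at which the interval centred at x0 stays in ]a, b[. *)
  exists (Num.min (x0 - a) (b - x0)); first by rewrite lt_min; lra.
  set e := Num.min _ _; have : e <= x0 - a /\ e <= b - x0.
    by rewrite !ge_min !lexx orbT.
  move=> [ea eb] u v xu uv vx; rewrite /= (shift u) (shift v); apply: incr.
  by exists (x0 + (u - x)), (x0 + (v - x)); split=> //; lra.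
have p0 := pi_gt0 R.
have [y ->] := expi_surj s; have [r [-> /andP[r1 r2] _]] := circle_polar y s'.
apply: (@ole_anti _ B).
  by rewrite -(expiD2pi (y + r)); apply: mono; lra.
by rewrite -(expiD2pi y); apply: mono; lra.
Qed.

End circle.

(** * The points over which a morphism is constant *)

Section constancy.
Variables (R : realType) (X Y : loSpace).
Variable h : loHom (lo_prod (directed_circle R) X) Y.

Definition cst_fibers : set X := [set t | forall s s', h (s, t) = h (s', t)].

Lemma cst_fibers_closed : hausdorff_space Y -> closed cst_fibers.
Proof.
move=> hY t clt s s'; apply: hY => A B.
have ct u : continuous (fun t => h (u, t)).
  move=> t'; apply: continuous_comp; last exact: loHom_continuous.
  move=> U [[V W] [/= Vu Wt] VWU]; apply: filterS Wt => w Ww.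
  by apply: VWU; split=> //; exact: nbhs_singleton Vu.
move=> nA nB; have clA := ct s t A nA; have clB := ct s' t B nB.
have [t' [Zt' [/= At' Bt']]] := clt _ (@filterI _ (nbhs t) _ _ _ clA clB).
by exists (h (s, t')); split=> //; rewrite (Zt' s s').
Qed.

(** The target poset [B] has to be the same for all points of the circle, and
    it is: the fiber over [t] is mapped to a single point, and [B] is any open
    poset around it. *)
Lemma cst_fibers_open : open cst_fibers.
Proof.
rewrite openE => t Zt.
have /ordered_basisP[oX _ _] := @open_posets_ordered_basis X.
have /ordered_basisP[oA _ _] := arcs_ordered_basis R.
have /ordered_basisP[_ bY _] := @open_posets_ordered_basis Y.
have [B [OB Bt _]] := bY (h (circle1 R, t)) setT openT I.
pose P t' s := exists alpha, [/\ arcs R alpha, carrier alpha s &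
  forall p q, ole alpha p q -> ole B (h (p, t')) (h (q, t'))].
have : nbhs t [set t' | [set: circle R] `<=` P t'].
  move/compact_near_coveringP : (@circle_compact R); apply => s _.
  have Bst : carrier B (h (s, t)) by rewrite (Zt s (circle1 R)).
  have [_ [[alpha aa [A OA <-]] [/= as_ At] _ incr]] := loHom_open_poset
    (lo_prod_class (lo_of_basis_class (arcs_ordered_basis R)) (open_posets_class X))
    OB Bst.
  exists (carrier alpha, carrier A) => /=.
    by split; apply: open_nbhs_nbhs; split=> //; [exact: oA|exact: oX].
  move=> [s' t'] [/= as' At']; exists alpha; split=> // p q pq.
  by apply: incr; split=> //; exact: ole_refl.
apply: filterS => t' Pt'; apply: (@locally_increasing_circle_cst R _ B) => s.
exact: Pt'.
Qed.

Lemma cst_fibers_clopen : hausdorff_space Y -> clopen cst_fibers.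
Proof. by move=> hY; split; [exact: cst_fibers_open|exact: cst_fibers_closed]. Qed.

End constancy.

(** * Nachbin orders *)

(** Closedness of the order, said with neighbourhoods in the ambient space
    instead of the topology of the carrier. *)
Lemma nachbinP (X : topologicalType) (A : oset X) :
  nachbin A <->
  forall p q, carrier A p -> carrier A q -> ~ ole A p q ->
    exists V W, [/\ nbhs p V, nbhs q W &
      forall p' q', V p' -> W q' -> ~ ole A p' q'].
Proof.
rewrite /nachbin -openC; split=> [oA p q Ap Aq npq|sep].
  pose p0 : set_type (carrier A) := exist _ p (mem_set Ap).
  pose q0 : set_type (carrier A) := exist _ q (mem_set Aq).
  have : nbhs (p0, q0) (~` [set p : set_type (carrier A) * set_type (carrier A) |
            ole A (set_val p.1) (set_val p.2)]).
    exact: open_nbhs_nbhs.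
  move=> [[V W] /= [[V1 [[V' oV' <-] /= Vp] sV] [W1 [[W' oW' <-] /= Wq] sW]] VW].
  exists V', W'; split; [exact: open_nbhs_nbhs..|].
  move=> p' q' Vp' Wq' p'q'; have [Ap' Aq'] := ole_supp p'q'.
  apply: (VW (exist _ p' (mem_set Ap'), exist _ q' (mem_set Aq'))) => //.
  by split; [exact: sV|exact: sW].
rewrite openE => -[p q] /= npq.
have [V [W [nV nW VW]]] := sep _ _ (set_mem (valP p)) (set_mem (valP q)) npq.
exists (set_val @^-1` V, set_val @^-1` W) => /=.
  by split; exact: (@initial_continuous _ _ (@set_val _ (carrier A))).
by move=> [p' q'] [/= Vp' Wq']; exact: VW.
Qed.

(** If the angle of the first point exceeds that of the second, any angle [c]
    strictly between them cuts the arc into two open arcs, and no point after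
    [c] is below a point before [c]. *)
Lemma arcs_nachbin (R : realType) (alpha : oset (circle R)) :
  arcs R alpha -> nachbin alpha.
Proof.
move=> [a [b [ab ->]]]; apply/nachbinP => _ _ [x /= xab <-] [y /= yab <-] nxy.
have yx : y < x by rewrite ltNge; apply/negP => xy; apply: nxy; exists x, y.
pose c := (x + y) / 2.
have cb : 0 < b - c < pi *+ 2 by move: ab; rewrite /c; lra.
have ac : 0 < c - a < pi *+ 2 by move: ab; rewrite /c; lra.
exists (arc c b), (arc a c); split.
- apply: open_nbhs_nbhs; split; first exact: arc_open.
  by exists x => //=; rewrite /c; lra.
- apply: open_nbhs_nbhs; split; first exact: arc_open.
  by exists y => //=; rewrite /c; lra.
move=> _ _ [x' /= x'cb <-] [y' /= y'ac <-] [x1 [y1 [x1ab y1ab ex ey xy1]]].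
have xx : x' = x1 by apply: (expi_inj ab) => //; rewrite /c in x'cb; lra.
have yy : y' = y1 by apply: (expi_inj ab) => //; rewrite /c in y'ac; lra.
by lra.
Qed.

(** * The space X_O for a clopen set O *)

Section XO.
Variables (R : realType) (X : loSpace) (O : set X).
Local Notation XO_top := (XO_top R O).
Local Notation q_fun := (@q_fun R X O).
Local Notation XO_snd := (@XO_snd R X O : XO_top -> X).

(** The value on the copy of [O] is arbitrary; it is constant so that the map is
    continuous when [O] is clopen. *)
Definition XO_fst (u : XO_top) : circle R :=
  match u with inl _ => circle1 R | inr st => st.1 end.

Lemma q_fun_fst_in s t : O t -> XO_fst (q_fun (s, t)) = circle1 R.
Proof. by rewrite /Defs.q_fun /=; case: pselect. Qed.

Lemma q_fun_fst_out s t : ~ O t -> XO_fst (q_fun (s, t)) = s.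
Proof. by rewrite /Defs.q_fun /=; case: pselect. Qed.

Lemma q_funK u : q_fun (XO_fst u, XO_snd u) = u.
Proof. by case: u => [t|[s t]]; [exact: q_fun_inlE|exact: q_fun_inrE]. Qed.

Lemma XO_snd_continuous : continuous XO_snd.
Proof.
apply/continuousP => U oU.
suff : open (q_fun @^-1` (XO_snd @^-1` U)) by [].
have -> : q_fun @^-1` (XO_snd @^-1` U) = snd @^-1` U.
  by apply/seteqP; split=> p /=; rewrite q_fun_snd.
have /continuousP : continuous (snd : circle R * X -> X).
  by move=> p; exact: cvg_snd.
exact.
Qed.

Lemma XO_fst_continuous : clopen O -> continuous XO_fst.
Proof.
move=> [oO cO]; apply/continuousP => U oU.
suff : open (q_fun @^-1` (XO_fst @^-1` U)) by [].
rewrite openE => -[s t] /=; have [Ot|NOt] := pselect (O t).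
  rewrite q_fun_fst_in// => U1.
  exists (setT, O) => /=; first by split; [exact: filterT|exact: open_nbhs_nbhs].
  by move=> [s' t'] [/= _ Ot']; rewrite q_fun_fst_in.
rewrite q_fun_fst_out// => Us; exists (U, ~` O) => /=.
  by split; apply: open_nbhs_nbhs; split=> //; exact: closed_openC.
by move=> [s' t'] [/= ? NOt']; rewrite q_fun_fst_out.
Qed.

(** The two projections are continuous, have Hausdorff targets and, together,
    are injective. *)
Lemma XO_hausdorff : clopen O -> hausdorff_space X -> hausdorff_space XO_top.
Proof.
move=> clO hX u v uv; rewrite -(q_funK u) -(q_funK v).
rewrite (cluster_image hX XO_snd_continuous uv).
by rewrite (cluster_image (@circle_hausdorff R) (XO_fst_continuous clO) uv).
Qed.

Section U_oset.
Variables (alpha : oset (circle R)) (A : oset X).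

Section inside.
Hypotheses (alpha0 : carrier alpha !=set0) (AO : carrier A `<=` O).

(** Over [O], [q_fun] forgets the point of the circle, so that a single [s] in
    [alpha] realizes all the relations of [A]. *)
Lemma U_le_in u v :
  ole (U_oset O alpha A) u v <-> ole A (XO_snd u) (XO_snd v).
Proof.
split=> [|uv]; first exact: U_le_snd.
have [s ss] := alpha0; have [Au Av] := ole_supp uv.
apply: t_step; exists (s, XO_snd u), (s, XO_snd v).
split; first by split=> //; exact: ole_refl.
  by rewrite -[RHS]q_funK; apply: q_fun_in; exact: AO.
by rewrite -[RHS]q_funK; apply: q_fun_in; exact: AO.
Qed.

Lemma U_carrier_in u : carrier (U_oset O alpha A) u <-> carrier A (XO_snd u).
Proof.
split=> [[p [_ Ap] <-]|Au]; first by rewrite q_fun_snd.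
by have [] := ole_supp ((U_le_in u u).2 (ole_refl Au)).
Qed.

End inside.

Section outside.
Hypothesis AO : carrier A `<=` ~` O.

(** Away from [O], [q_fun] is injective, so that the image of the product order
    is already transitive. *)
Lemma U_le_out u v : ole (U_oset O alpha A) u v <->
  ole alpha (XO_fst u) (XO_fst v) /\ ole A (XO_snd u) (XO_snd v).
Proof.
split=> [|[suv uv]]; last first.
  apply: t_step; exists (XO_fst u, XO_snd u), (XO_fst v, XO_snd v).
  by rewrite !q_funK.
elim=> {u v} [_ _ [[s t] [[s' t'] [[/= ss' tt'] <- <-]]]|u v w _ [a b] _ [c d]].
  have [/AO NOt /AO NOt'] := ole_supp tt'.
  by rewrite !q_fun_snd !q_fun_fst_out.
by split; [exact: ole_trans c|exact: ole_trans d].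
Qed.

Lemma U_carrier_out u : carrier (U_oset O alpha A) u <->
  carrier alpha (XO_fst u) /\ carrier A (XO_snd u).
Proof.
split=> [Uu|[su tu]].
  have [su tu] := (U_le_out u u).1 (ole_refl Uu).
  by have [? _] := ole_supp su; have [? _] := ole_supp tu.
by exists (XO_fst u, XO_snd u); [|exact: q_funK].
Qed.

End outside.

Hypothesis clO : clopen O.
Hypothesis AO : carrier A `<=` O \/ carrier A `<=` ~` O.

(** The order of [U_oset O alpha A] is pulled back from [A], or from the product
    of [alpha] and [A], by the continuous projections. *)
Lemma U_oset_nachbin : arcs R alpha -> nachbin A -> nachbin (U_oset O alpha A).
Proof.
move=> aalpha /nachbinP nA; apply/nachbinP => u v.
have alpha0 := arcs_nonempty aalpha.
have csnd := XO_snd_continuous; have cfst := XO_fst_continuous clO.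
case: AO => AO1.
  rewrite !U_carrier_in// => Au Av.
  move=> /(contra_not (U_le_in alpha0 AO1 u v).2)/(nA _ _ Au Av)[V [W [nV nW VW]]].
  exists (XO_snd @^-1` V), (XO_snd @^-1` W); split; [exact: csnd..|].
  by move=> u' v' /= Vu' Wv' /U_le_snd; exact: VW.
rewrite !U_carrier_out// => -[au Au] [av Av] nuv.
have [tuv|ntuv] := pselect (ole A (XO_snd u) (XO_snd v)).
  have nsuv : ~ ole alpha (XO_fst u) (XO_fst v).
    by move=> suv; apply/nuv/U_le_out.
  have [V [W [nV nW VW]]] := (nachbinP alpha).1 (arcs_nachbin aalpha) _ _ au av nsuv.
  exists (XO_fst @^-1` V), (XO_fst @^-1` W); split; [exact: cfst..|].
  by move=> u' v' /= Vu' Wv' uv'; have [+ _] := (U_le_out AO1 u' v').1 uv'; exact: VW.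
have [V [W [nV nW VW]]] := nA _ _ Au Av ntuv.
exists (XO_snd @^-1` V), (XO_snd @^-1` W); split; [exact: csnd..|].
by move=> u' v' /= Vu' Wv' /U_le_snd; exact: VW.
Qed.

End U_oset.

Lemma U_oset_str_in (alpha alpha' : oset (circle R)) (A A' : oset X) :
  carrier alpha !=set0 -> carrier alpha' !=set0 -> carrier A' `<=` O ->
  sub_str A A' -> sub_str (U_oset O alpha A) (U_oset O alpha' A').
Proof.
move=> a0 a0' AO' [sA oA].
have AO : carrier A `<=` O by exact: subset_trans AO'.
split=> [u|u v]; rewrite !U_carrier_in//; first exact: sA.
by move=> Au Av; rewrite !U_le_in//; exact: oA.
Qed.

Lemma U_oset_str_out (alpha alpha' : oset (circle R)) (A A' : oset X) :
  carrier A' `<=` ~` O -> sub_str alpha alpha' -> sub_str A A' ->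
  sub_str (U_oset O alpha A) (U_oset O alpha' A').
Proof.
move=> AO' [sa oa] [sA oA].
have AO : carrier A `<=` ~` O by exact: subset_trans AO'.
split=> [u|u v]; rewrite !U_carrier_out//; first by move=> [/sa ? /sA ?].
by move=> [au Au] [av Av]; rewrite !U_le_out// oa// oA.
Qed.

Hypothesis clO : clopen O.
Variable oO : open O.
Local Notation XO := (XO R oO).

(** In these posets no chain leaves or enters [O]: this is where the transitive
    closure in the order of [X_O] becomes explicit. *)
Definition split_part (F : set (oset X)) : set (oset X) :=
  [set A | F A /\ (carrier A `<=` O \/ carrier A `<=` ~` O)].

Lemma split_part_class F : lo_class F -> lo_class (split_part F).
Proof.
move=> cF; apply: lo_class_refine; first by move=> A [/(lo_class_open_posets cF)].
move=> t A OA At.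
have /ordered_basisP[_ bX iX] := @open_posets_ordered_basis X.
have [D [OD Dt DO]] : exists D, [/\ open_posets X D, carrier D t &
    carrier D `<=` O \/ carrier D `<=` ~` O].
  have [Ot|NOt] := pselect (O t).
    by have [D [? ? ?]] := bX t O oO Ot; exists D; split=> //; left.
  have [D [? ? ?]] := bX t (~` O) (closed_openC clO.2) NOt.
  by exists D; split=> //; right.
have [E [OE Et EA [ED _]]] := iX t A D OA OD At Dt.
have [B [FB Bt BE]] := OE F cF t Et.
exists B; split=> //; last exact: sub_lax_trans EA.
case: BE => BE _; have BD := subset_trans BE ED.
by split=> //; case: DO => DO; [left|right]; exact: subset_trans DO.
Qed.

Definition XO_basis_of (G : set (oset X)) : set (oset XO_top) :=
  [set U_oset O alpha A | alpha in arcs R & A in G].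

Lemma XO_basis_of_class G : lo_class G -> @lo_class XO (XO_basis_of G).
Proof.
move=> cG; have cXO : @lo_class XO (@XO_basis R X O) by exact: lo_of_basis_class.
apply: lo_class_refine => [_ [alpha aa [A GA <-]]|u P OP Pu].
  apply: (lo_class_open_posets cXO); exists alpha => //; exists A => //.
  exact: (lo_class_open_posets cG).
have [_ [[alpha aa [A OA <-]] [[s t] [/= as_ At] <-] UP]] := OP _ cXO u Pu.
have [B [GB Bt BA]] := OA G cG t At.
exists (U_oset O alpha B); split; first by exists alpha => //; exists B.
  by exists (s, t).
by apply: sub_lax_trans UP; apply: U_oset_lax => //; exact: sub_lax_refl.
Qed.

(** Over [O] the order comes from [X] alone, and a poset that works for [X]
    gives one for [X_O]; away from [O] the order is a product, and one also uses
    that the arcs are a strict basis of the directed circle. *)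
Lemma XO_strict : strict_lo X -> strict_lo XO.
Proof.
move=> [F cF [_ strF]].
have cXO := XO_basis_of_class (split_part_class cF).
exists (XO_basis_of (split_part F)) => //; split; first exact: lo_class_basis cXO.
move=> u _ _ [alpha aa [A [FA AO] <-]] [beta bb [B [FB BO] <-]] Au Bu.
have [/= sndA sndB] : carrier A (XO_snd u) /\ carrier B (XO_snd u).
  have [p [_ pA] eA] := Au; have [p' [_ pB] eB] := Bu.
  by split; [rewrite -eA q_fun_snd|rewrite -eB q_fun_snd].
have [D [FD Du DA DB]] := strF (XO_snd u) A B FA FB sndA sndB.
have [Ou|NOu] := pselect (O (XO_snd u)).
  have {}AO : carrier A `<=` O by case: AO => // /(_ _ sndA).
  have {}BO : carrier B `<=` O by case: BO => // /(_ _ sndB).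
  have DO : carrier D `<=` O by case: DA => DA _; exact: subset_trans AO.
  exists (U_oset O alpha D); split.
  - by exists alpha => //; exists D => //; split=> //; left.
  - by apply/U_carrier_in => //; exact: arcs_nonempty.
  - by apply: U_oset_str_in => //; exact: arcs_nonempty.
  - by apply: U_oset_str_in => //; exact: arcs_nonempty.
have {}AO : carrier A `<=` ~` O by case: AO => // /(_ _ sndA).
have {}BO : carrier B `<=` ~` O by case: BO => // /(_ _ sndB).
have DO : carrier D `<=` ~` O by case: DA => DA _; exact: subset_trans AO.
have [au _] := (U_carrier_out alpha AO u).1 Au.
have [bu _] := (U_carrier_out beta BO u).1 Bu.
have [gamma [gg gu ga gb]] := arcs_inter aa bb au bu.
exists (U_oset O gamma D); split.
- by exists gamma => //; exists D => //; split=> //; right.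
- by apply/U_carrier_out.
- exact: U_oset_str_out.
- exact: U_oset_str_out.
Qed.

Lemma XO_locally_nachbin : locally_nachbin X -> locally_nachbin XO.
Proof.
move=> nX u P OP Pu.
have cS := split_part_class (open_posets_class X).
have [_ [[alpha aa [A [OA AO] <-]] [[s t] [/= as_ At] <-] UP]] :=
  OP _ (XO_basis_of_class cS) u Pu.
have [B [OB Bt BA nB]] := nX t A OA At.
have cXO := XO_basis_of_class (open_posets_class X).
exists (U_oset O alpha B); split.
- by apply: (lo_class_open_posets cXO); exists alpha => //; exists B.
- by exists (s, t).
- by apply: sub_lax_trans UP; apply: U_oset_lax => //; exact: sub_lax_refl.
- apply: U_oset_nachbin => //.
  by case: AO => AO; [left|right]; apply: subset_trans AO; case: BA.
Qed.

Lemma XO_objects C : objects C X -> objects C XO.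
Proof.
move=> [hX cX]; split; first exact: XO_hausdorff.
case: C cX => //=; [exact: XO_strict|exact: XO_locally_nachbin|].
by move=> [sX nX]; split; [exact: XO_strict|exact: XO_locally_nachbin].
Qed.

End XO.

(** * The universal property *)

Section factorization.
Variables (R : realType) (X : loSpace) (O : set X) (oO : open O) (Y : loSpace).
Variable h : loHom (lo_prod (directed_circle R) X) Y.
Hypothesis Oh : O `<=` cst_fibers h.

Definition XO_lift (u : XO R oO) : Y := h (XO_fst u, XO_snd u).

Lemma XO_lift_q p : XO_lift (q_fun O p) = h p.
Proof.
rewrite /XO_lift q_fun_snd; case: p => s t /=.
by have [Ot|NOt] := pselect (O t); [exact: Oh|rewrite q_fun_fst_out].
Qed.

(** If [h] is increasing from [alpha x A] to [B], the lift is increasing on the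
    image of [alpha x A], as the order there is generated by the image of the
    product order. *)
Lemma XO_liftP u : @locally_increasing_at (XO R oO) Y XO_lift u.
Proof.
apply: locally_increasing_atP; [exact: lo_of_basis_class|exact: open_posets_class|].
move=> B OB Bu.
have [_ [[alpha aa [A OA <-]] [/= as_ At] hB incr]] := loHom_open_poset
  (lo_prod_class (lo_of_basis_class (arcs_ordered_basis R)) (open_posets_class X))
  OB Bu.
exists (U_oset O alpha A); split; first by exists alpha => //; exists A.
- by rewrite -[u]q_funK; exists (XO_fst u, XO_snd u).
- by move=> _ [_ [p /hB Bp <-] <-]; rewrite XO_lift_q.
- move=> v w; elim=> {v w} [_ _ [p [p' [pp' <- <-]]]|v w x _ vw _ wx].
    by rewrite !XO_lift_q; exact: incr.
  exact: ole_trans wx.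
Qed.

Definition XO_lift_map : loHom (XO R oO) Y := LoHom XO_liftP.

End factorization.

Lemma q_map_coequalizes (R : realType) (X : loSpace) (O : set X) (oO : open O) pt :
  O pt -> forall s, q_map R oO (i_map R pt s) = q_map R oO (c_map R pt s).
Proof. by move=> Opt s; exact: q_fun_in. Qed.

Lemma q_map_coequalizer (R : realType) (C : lo_category) (X : loSpace) (pt : X)
    (O : set X) (oO : open O) :
  objects C X -> smallest_clopen_nbhs pt O ->
  is_coequalizer C (i_map R pt) (c_map R pt) (q_map R oO).
Proof.
move=> hX [clO Opt minO]; split; first exact: XO_objects.
  exact: q_map_coequalizes.
move=> Y h [hY _] hic.
have Oh : O `<=` cst_fibers h.
  apply: minO; first exact: cst_fibers_clopen.
  by move=> s s'; rewrite (hic s) (hic s').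
exists (XO_lift_map oO Oh); split; first by move=> p; exact: XO_lift_q.
move=> k kq; apply: loHom_eq => u /=.
by rewrite -[in RHS](q_funK u); exact: esym (kq (XO_fst u, XO_snd u)).
Qed.

Lemma expi0_expipi (R : realType) : expi (0 : R) <> expi pi.
Proof. by move=> /expi_eq[]; rewrite cos0 cospi; lra. Qed.

(** The existence of a coequalizer [q] forces a smallest clopen neighbourhood:
    it is the set of points over which [q] is constant, because each [q_U]
    factors through [q] and separates the points of the circle over the
    complement of [U]. *)
Lemma coequalizer_smallest_clopen_nbhs (R : realType) (C : lo_category)
    (X Q : loSpace) (pt : X) (q : loHom (lo_prod (directed_circle R) X) Q) :
  objects C X -> is_coequalizer C (i_map R pt) (c_map R pt) q ->
  smallest_clopen_nbhs pt (cst_fibers q).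
Proof.
move=> hX [[hQ _] qic univ]; split; first exact: cst_fibers_clopen.
  by move=> s s'; rewrite (qic s) (qic s').
move=> U clU Upt t Zt; have oU := clU.1.
have [k [kq _]] := univ _ (q_map R oU) (XO_objects R clU oU hX)
  (q_map_coequalizes oU Upt).
apply: contrapT => NUt; apply: (@expi0_expipi R).
have := congr1 k (Zt (expi 0) (expi pi)); rewrite !kq => /(congr1 (@XO_fst R X U)).
by rewrite /= !q_fun_fst_out.
Qed.

Theorem corollary3p18 (R : realType) (C : lo_category) (X : loSpace)
    (hX : objects C X) (pt : X) :
  ((exists (Q : loSpace) (q : loHom (lo_prod (directed_circle R) X) Q),
      is_coequalizer C (i_map R pt) (c_map R pt) q) <->
   (exists O : set X, smallest_clopen_nbhs pt O)) /\
  (forall (O : set X) (oO : open O), smallest_clopen_nbhs pt O ->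
     is_coequalizer C (i_map R pt) (c_map R pt) (q_map R oO)).
Proof.
split=> [|O oO]; last exact: q_map_coequalizer.
split=> [[Q [q coeq]]|[U minU]].
  by exists (cst_fibers q); exact: coequalizer_smallest_clopen_nbhs coeq.
have [[oU _] _ _] := minU.
by exists (XO R oU), (q_map R oU); exact: q_map_coequalizer.
Qed.
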